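(* Suppose the Hanna Neumann conjecture is false, i.e. there exist a free group $F$ and nontrivial finitely generated subgroups $H_0,K_0\leqslant F$ with $\mathrm{rank}(H_0\cap K_0)-1>[\mathrm{rank}(H_0)-1][\mathrm{rank}(K_0)-1]$. Then there is a counterexample in the free group $F_2=F(a,b)$, i.e. there are nontrivial finitely generated subgroups $H,K\leqslant F_2$ with $$\mathrm{rank}(H\cap K)-1>[\mathrm{rank}(H)-1][\mathrm{rank}(K)-1],$$ having the additional property that all the branch vertices in the foldings $\Gamma_H$ and $\Gamma_K$ are of degree $3$, and all degree $3$ vertices (of both foldings) have the same type.
   Context: Folding: for a finitely generated subgroup $H=\langle w_1,\dots,w_n\rangle\leqslant F_2=F(a,b)$ (with $w_i$ nontrivial reduced words), the folding $\Gamma_H=(V_H,E_H)$ is the finite directed graph with edges labelled by $a,b$, with a base vertex $1_H$, obtained as follows. Take cycles $c_1,\dots,c_n$ with $|w_i|$ vertices in $c_i$, pick one vertex in each cycle and identify these to a single vertex $1_H$; label the edges of $c_i$ by the successive letters of $w_i$ starting at $1_H$ (a letter $x^{-1}$ corresponds to an edge labelled $x$ traversed backwards). Then repeatedly identify pairs of distinct edges with the same label and the same head or the same tail, until no such pair remains. The result does not depend on the generating set or on the order of the identifications. Degree and type: the degree of a vertex is the number of incoming plus the number of outgoing edges at it (so a loop counts twice; degrees are at most $4$). A branch vertex is a vertex of degree at least $3$. At a vertex $v$, an outgoing edge labelled $x\in\{a,b\}$ is recorded as the letter $x$ and an incoming edge labelled $x$ as the letter $x^{-1}$; in a folding each of the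 four letters $a,a^{-1},b,b^{-1}$ is recorded at most once at $v$. The type of a degree $3$ vertex is determined by the set of three letters recorded at it (equivalently, by the one missing letter), so there are four types. The rank of a free group is the size of a basis; the trivial group has rank $0$. *)

(* Defs.v *)
(* MathComp, with MathComp-Analysis' classical_sets for subgroups of possibly
   infinite groups. *)
From HB Require Import structures.
From Stdlib Require Import Relation_Operators.
From mathcomp Require Import all_boot all_order all_algebra.
From mathcomp Require Import boolp classical_sets.

Set Implicit Arguments.
Unset Strict Implicit.
Unset Printing Implicit Defensive.

Local Open Scope classical_set_scope.
Local Open Scope group_scope.

(* The letter x is (x, false) and the letter x^-1 is (x, true). *)
Definition letter (X : Type) : Type := (X * bool)%type.

Definition inv_letter (X : Type) (l : letter X) : letter X := (l.1, ~~ l.2).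

Definition reduced (X : eqType) (w : seq (X * bool)) : bool :=
  sorted (fun l m : X * bool => m != inv_letter l) w.

Section FreeGroup.
Variable X : choiceType.
Implicit Types (l m : X * bool) (u v w : seq (X * bool)).

Record free_group := FreeGroup {
  word :> seq (X * bool);
  word_reduced : reduced word }.

HB.instance Definition _ := [isSub for word].
HB.instance Definition _ := [Choice of free_group by <:].

(* Reduced form of l w, when w is reduced. *)
Definition push l w : seq (X * bool) :=
  if w is m :: w' then if m == inv_letter l then w' else l :: w else [:: l].

Definition mul_word u v : seq (X * bool) := foldr push v u.

Definition inv_word u : seq (X * bool) := rev (map (@inv_letter X) u).

Lemma inv_letterK : involutive (@inv_letter X).
Proof. by case=> x b; rewrite /inv_letter /= negbK. Qed.

Lemma push_reduced l w : reduced w -> reduced (push l w).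
Proof.
case: w => [|m w] //= rw; case: eqP => [_|/eqP ml]; first exact: path_sorted rw.
by rewrite /reduced /= ml.
Qed.

Lemma mul_word_reduced u v : reduced v -> reduced (mul_word u v).
Proof. by move=> rv; elim: u => //= l u; apply: push_reduced. Qed.

Lemma inv_word_reduced u : reduced u -> reduced (inv_word u).
Proof.
rewrite /reduced /inv_word rev_sorted sorted_map; apply: sub_sorted => l m /=.
by rewrite inv_letterK eq_sym.
Qed.

Lemma push_invK l w : reduced w -> push l (push (inv_letter l) w) = w.
Proof.
case: w => [|m w] /=; first by rewrite eqxx.
rewrite inv_letterK; case: eqP => [-> |_ _] /=; last by rewrite eqxx.
by case: w => //= k w; rewrite /reduced /= => /andP[/negPf-> _].
Qed.

Lemma mul_push l u v : reduced v ->
  mul_word (push l u) v = push l (mul_word u v).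
Proof.
move=> rv; case: u => [|m u] //=; case: eqP => [->|//].
by rewrite push_invK // mul_word_reduced.
Qed.

Lemma mul_wordA u v w : reduced w ->
  mul_word u (mul_word v w) = mul_word (mul_word u v) w.
Proof. by move=> rw; elim: u => //= l u ->; rewrite mul_push. Qed.

Lemma mul_word1 u : reduced u -> mul_word u [::] = u.
Proof.
elim: u => //= l u IH ru; rewrite (IH (path_sorted ru)).
by case: u ru {IH} => //= m u; rewrite /reduced /= => /andP[/negPf-> _].
Qed.

Lemma mul_Vword u : mul_word (inv_word u) u = [::].
Proof.
elim: u => //= l u IH; rewrite /inv_word /= rev_cons /mul_word foldr_rcons /=.
by rewrite inv_letterK eqxx.
Qed.

Lemma inv_wordK : involutive inv_word.
Proof.
by move=> u; rewrite /inv_word map_rev revK -map_comp map_id_in // => l _ /=;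
  rewrite inv_letterK.
Qed.

Definition free_one : free_group := @FreeGroup [::] isT.
Definition free_mul (g h : free_group) : free_group :=
  FreeGroup (mul_word_reduced g (word_reduced h)).
Definition free_inv (g : free_group) : free_group :=
  FreeGroup (inv_word_reduced (word_reduced g)).

Lemma free_mulA : associative free_mul.
Proof. by move=> g h k; apply: val_inj; exact: mul_wordA (word_reduced k). Qed.
Lemma free_mul1g : left_id free_one free_mul.
Proof. by move=> g; apply: val_inj. Qed.
Lemma free_mulg1 : right_id free_one free_mul.
Proof. by move=> g; apply: val_inj; exact: mul_word1 (word_reduced g). Qed.
Lemma free_mulVg : left_inverse free_one free_inv free_mul.
Proof. by move=> g; apply: val_inj; exact: mul_Vword. Qed.
Lemma free_mulgV : right_inverse free_one free_inv free_mul.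
Proof.
by move=> g; apply: val_inj => /=; rewrite -{1}[word g]inv_wordK mul_Vword.
Qed.

HB.instance Definition _ := isGroup.Build free_group
  free_mulA free_mul1g free_mulg1 free_mulVg free_mulgV.

End FreeGroup.

(* The generator a is false and the generator b is true. *)
Definition F2 : groupType := free_group bool.

Section Rank.
Variable G : groupType.

Definition is_subgroup (H : set G) : Prop :=
  H 1 /\ forall x y, H x -> H y -> H (x * y^-1).

Definition generated (A : set G) : set G := smallest is_subgroup A.

Definition finitely_generated (H : set G) : Prop :=
  exists s : seq G, H = generated [set` s].

Definition word_value (X : Type) (f : X -> G) (w : seq (X * bool)) : G :=
  \prod_(l <- w) (if l.2 then (f l.1)^-1 else f l.1).

(* The family f (necessarily injective) is a basis of the subgroup H. *)
Definition free_basis (X : eqType) (f : X -> G) (H : set G) : Prop :=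
  H = generated (range f) /\
  forall w : seq (X * bool), reduced w -> word_value f w = 1 -> w = [::].

(* Number of elements of a finite basis of H, with junk value 0 when there is
   none; finitely generated subgroups of free groups, and their intersections
   (Howson), always have one. *)
Definition rank (H : set G) : nat :=
  xget 0%N [set n | exists f : 'I_n -> G, free_basis f H].

Definition hanna_neumann_counterexample (H K : set G) : Prop :=
  [/\ finitely_generated H /\ H <> [set 1],
      finitely_generated K /\ K <> [set 1] &
      ((rank (H `&` K))%:Z - 1 > ((rank H)%:Z - 1) * ((rank K)%:Z - 1))%R].

End Rank.

Definition is_free (F : groupType) : Prop :=
  exists (X : eqType) (f : X -> F), free_basis f [set: F].

Section Folding.
Variable X : finType.

(* Finite directed multigraphs with a base vertex and edges labelled in X. *)
Record lgraph := LGraph {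
  vertex : finType;
  edge : finType;
  tail : edge -> vertex;
  head : edge -> vertex;
  label : edge -> X;
  base : vertex }.

Section Wedge.
Variable ws : seq (free_group X).

Definition wedge_word (i : 'I_(size ws)) : seq (X * bool) :=
  word (tnth (in_tuple ws) i).

(* None is the vertex shared by all the cycles, and Some (i, k) is the
   vertex of the i-th cycle reached after reading k.+1 letters. *)
Definition wedge_vertex : Type :=
  option {i : 'I_(size ws) & 'I_(size (wedge_word i)).-1}.

Definition wedge_edge : Type :=
  {i : 'I_(size ws) & 'I_(size (wedge_word i))}.

HB.instance Definition _ := Finite.on wedge_vertex.
HB.instance Definition _ := Finite.on wedge_edge.

(* The vertex of the i-th cycle reached after reading j letters: insub k is
   None as soon as k.+1 = size (wedge_word i). *)
Definition wedge_pos (i : 'I_(size ws)) (j : nat) : wedge_vertex :=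
  if j is k.+1 then
    omap (existT (fun i => 'I_(size (wedge_word i)).-1 : Type) i) (insub k)
  else None.

Definition wedge_letter (e : wedge_edge) : X * bool :=
  tnth (in_tuple (wedge_word (tag e))) (tagged e).

(* An edge carrying x^-1 is an edge labelled x traversed backwards. *)
Definition wedge : lgraph := {|
  vertex := wedge_vertex;
  edge := wedge_edge;
  tail := fun e => wedge_pos (tag e) (tagged e + (wedge_letter e).2);
  head := fun e => wedge_pos (tag e) (tagged e + ~~ (wedge_letter e).2);
  label := fun e => (wedge_letter e).1;
  base := None |}.

End Wedge.

Definition foldable (A : lgraph) (e1 e2 : edge A) : Prop :=
  [/\ e1 <> e2, label e1 = label e2 &
      tail e1 = tail e2 \/ head e1 = head e2].

(* B is (isomorphic to) the quotient of A in which e1 and e2, hence also their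
   tails and their heads, are identified. *)
Definition identifies (A : lgraph) (e1 e2 : edge A) (B : lgraph) : Prop :=
  exists (p : vertex A -> vertex B) (q : edge A -> edge B),
  [/\ [/\ forall e, tail (q e) = p (tail e),
          forall e, head (q e) = p (head e),
          forall e, label (q e) = label e & base B = p (base A)],
      (forall v, exists u, p u = v) /\ (forall d, exists e, q e = d),
      forall u v, p u = p v <->
        clos_refl_sym_trans _ (fun x y => (x = tail e1 /\ y = tail e2) \/
                                          (x = head e1 /\ y = head e2)) u v &
      forall c d, q c = q d <->
        clos_refl_sym_trans _ (fun x y => x = e1 /\ y = e2) c d].

Definition fold_step (A B : lgraph) : Prop :=
  exists e1 e2 : edge A, foldable e1 e2 /\ identifies e1 e2 B.

(* A is a folding of H; it is determined by H up to isomorphism. *)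
Definition is_folding (H : set (free_group X)) (A : lgraph) : Prop :=
  exists ws : seq (free_group X),
  [/\ 1 \notin ws, H = generated [set` ws],
      clos_refl_trans _ fold_step (wedge ws) A &
      forall e1 e2 : edge A, ~ foldable e1 e2].

Definition degree (A : lgraph) (v : vertex A) : nat :=
  #|[pred e : edge A | tail e == v]| + #|[pred e : edge A | head e == v]|.

Definition branch (A : lgraph) (v : vertex A) : Prop := (3 <= degree v)%N.

Definition recorded (A : lgraph) (v : vertex A) : {set X * bool} :=
  finset (fun l : X * bool => [exists e : edge A,
    (label e == l.1) && ((if l.2 then head e else tail e) == v)]).

End Folding.

(* Main.v *)
Require Import Defs.
From mathcomp Require Import all_boot classical_sets.
From Stdlib Require Import Relation_Operators.
From mathcomp Require Import boolp.
(* seq also has a head; the head of an edge takes precedence. *)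
Import Defs.

Set Implicit Arguments.
Unset Strict Implicit.
Unset Printing Implicit Defensive.

Local Open Scope classical_set_scope.
Local Open Scope group_scope.

(** Rank, finite generation and intersections only see a subgroup up to an
    injective homomorphism ([counterexample_image]).  As [H0] and [K0] are
    finitely generated, they involve only finitely many letters of a basis of
    [F], so the counterexample may be taken in a free group on a finite
    alphabet ([counterexample_finite_alphabet]).  It remains to embed that
    group in [F2] in such a way that all its subgroups have the right foldings.

    The embedding is read off from an infinite deterministic graph, the comb:
    a line of [a]-edges from vertex to vertex, [L 0, L 1, ...], with a tooth
    [L k -b-> T k] at each vertex, and an [a]-edge from [T (2i)] to
    [T (2i+1)] joining the teeth two by two:
<<
       T0 -a-> T1      T2 -a-> T3
       ^       ^       ^       ^
       b       b       b       b
       |       |       |       |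
       L0 -a-> L1 -a-> L2 -a-> L3 -a-> ...
>>
    The [i]-th generator goes to a^(2i) b a b^-1 a^-(2i+1), the loop at [L 0]
    that crosses the [i]-th bridge [T (2i) -> T (2i+1)].  To see that these
    loops are free, put the [i]-th generator as a voltage on the [i]-th bridge:
    reading the image of [w] multiplies the voltages into [w] itself, so the
    image determines [w] ([comb_embed_inj]).

    In the comb every [T k] has degree 2 and every [L k] records at most
    [a, a^-1, b].  If [H] lies in the image of the embedding, its generators
    are loops at [L 0], so the wedge of cycles maps to the comb.  The comb is
    deterministic, hence the map survives every folding step
    ([tracks_folding]).  In a folding different edges at a vertex carry
    different letters, so the degree of a vertex is the number of letters
    recorded there ([degree_recorded]), and these letters are also available
    at its image in the comb.  Thus the degree is at most 3, and it is 3 only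
    if exactly [a, a^-1, b] are recorded ([comb_folding]). *)

(** * Subgroups and word values *)

Section Subgroups.
Variable G : groupType.
Implicit Types (A H : set G) (x y : G).

Lemma is_subgroupV H x : is_subgroup H -> H x -> H x^-1.
Proof. by case=> H1 HB Hx; rewrite -[x^-1]mul1g; apply: HB. Qed.

Lemma is_subgroupM H x y : is_subgroup H -> H x -> H y -> H (x * y).
Proof.
move=> sH Hx Hy; rewrite -[y]invgK; apply: sH.2 => //.
exact: is_subgroupV.
Qed.

Lemma generated_subgroup A : is_subgroup (generated A).
Proof.
split=> [B [[B1 _] _] // | x y Hx Hy B [sB AB]].
by apply: sB.2; [apply: Hx | apply: Hy].
Qed.

Lemma sub_generated A : A `<=` generated A.
Proof. exact: sub_gen_smallest. Qed.

Lemma generated_min A H : is_subgroup H -> A `<=` H -> generated A `<=` H.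
Proof. exact: smallest_sub. Qed.

Lemma generated_filter1 (s : seq G) :
  generated [set` s] = generated [set` [seq x <- s | x != 1]].
Proof.
apply/seteqP; split; apply: generated_min; try exact: generated_subgroup.
  move=> x /= xs; have [->|x1] := eqVneq x 1.
    exact: (generated_subgroup _).1.
  by apply: sub_generated; rewrite /= mem_filter x1.
by move=> x /=; rewrite mem_filter => /andP[_ xs]; exact: sub_generated.
Qed.

Lemma word_value_cons (X : Type) (f : X -> G) l w :
  word_value f (l :: w) = (if l.2 then (f l.1)^-1 else f l.1) * word_value f w.
Proof. by rewrite /word_value big_cons. Qed.

Lemma word_value_map (X Y : Type) (f : Y -> G) (g : X -> Y) w :
  word_value f [seq (g l.1, l.2) | l <- w] = word_value (f \o g) w.
Proof. by rewrite /word_value big_map. Qed.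

Lemma word_value_inv (X : Type) (f : X -> G) w :
  word_value f (rev (map (@inv_letter X) w)) = (word_value f w)^-1.
Proof.
rewrite /word_value; elim: w => [|[x b] w IH] /=.
  by rewrite !big_nil invg1.
rewrite rev_cons -cats1 big_cat big_seq1 IH big_cons invgM.
by case: b; rewrite /= ?invgK.
Qed.

Lemma word_value_push (X : choiceType) (f : X -> G) l w :
  word_value f (push l w) = word_value f (l :: w).
Proof.
case: w => [|m w] //=; case: eqP => [->|//].
by rewrite !word_value_cons mulgA; case: l => x [] /=; rewrite !gsimp.
Qed.

Lemma word_value_mul (X : choiceType) (f : X -> G) :
  {morph (fun g : free_group X => word_value f g) : g h / g * h}.
Proof.
move=> g h; rewrite /=.
elim: (word g) => [|l w IH] /=; first by rewrite {2}/word_value big_nil mul1g.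
by rewrite word_value_push !word_value_cons IH mulgA.
Qed.


End Subgroups.

Lemma reduced_map (X Y : eqType) (g : X -> Y) (w : seq (X * bool)) :
  injective g -> reduced [seq (g l.1, l.2) | l <- w] = reduced w.
Proof.
move=> g_inj; rewrite /reduced sorted_map; apply: eq_sorted => -[x b] [y c] /=.
by rewrite /inv_letter !xpair_eqE (inj_eq g_inj).
Qed.

Definition free_gen (X : choiceType) (x : X) : free_group X :=
  @FreeGroup X [:: (x, false)] isT.

Lemma word_value_free_gen (X : choiceType) (g : free_group X) :
  word_value (@free_gen X) g = g.
Proof.
apply: val_inj; rewrite /= -[RHS]mul_word1 ?word_reduced //.
elim: (word g) => [|l w IH]; first by rewrite /word_value big_nil.
by rewrite word_value_cons; case: l => x [] /=; rewrite -IH.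
Qed.

(** * Transport along injective homomorphisms *)

Section Transport.
Variables (G G' : groupType) (theta : G -> G').
Hypothesis thetaM : {morph theta : x y / x * y}.

Lemma morph1g : theta 1 = 1.
Proof. by apply: (mulgI (theta 1)); rewrite -thetaM !mulg1. Qed.

Lemma morphVg x : theta x^-1 = (theta x)^-1.
Proof. by apply/esym/mulg1_eq; rewrite -thetaM mulgV morph1g. Qed.

Lemma image_subgroup (H : set G) : is_subgroup H -> is_subgroup (theta @` H).
Proof.
move=> sH; split; first by exists 1; [exact: sH.1 | exact: morph1g].
move=> _ _ [x Hx <-] [y Hy <-]; exists (x * y^-1); first exact: sH.2.
by rewrite thetaM morphVg.
Qed.

Lemma preimage_subgroup (H : set G') :
  is_subgroup H -> is_subgroup (theta @^-1` H).
Proof.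
move=> sH; split; first by rewrite /= morph1g; apply: sH.1.
by move=> x y Hx Hy; rewrite /= thetaM morphVg; apply: sH.2.
Qed.

Lemma image_generated (A : set G) :
  theta @` generated A = generated (theta @` A).
Proof.
apply/seteqP; split; last first.
  apply: generated_min; first exact: image_subgroup (generated_subgroup _).
  by apply: image_subset; apply: sub_generated.
suff: generated A `<=` theta @^-1` generated (theta @` A).
  by move=> sub _ [x /sub ? <-].
apply: generated_min; first exact: preimage_subgroup (generated_subgroup _).
by move=> x Ax; apply: sub_generated; exists x.
Qed.

Lemma morph_word_value (X : Type) (f : X -> G) w :
  theta (word_value f w) = word_value (theta \o f) w.
Proof.
elim: w => [|l w IH]; first by rewrite /word_value !big_nil morph1g.
by rewrite !word_value_cons thetaM IH; case: l => x []; rewrite /= ?morphVg.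
Qed.

Hypothesis theta_inj : injective theta.

Lemma image_set_inj : injective (fun A : set G => theta @` A).
Proof.
move=> A B eqAB; apply/seteqP; split=> x xS.
  by rewrite -(image_inj theta_inj) -eqAB; exists x.
by rewrite -(image_inj theta_inj) eqAB; exists x.
Qed.

Lemma image_setI_inj (A B : set G) :
  theta @` (A `&` B) = theta @` A `&` theta @` B.
Proof.
apply/seteqP; split; first exact: sub_image_setI.
move=> _ [[x Ax <-] [y By /theta_inj yx]].
by exists x; rewrite // -yx in Ax *.
Qed.

Lemma image_fg (H : set G) :
  finitely_generated (theta @` H) <-> finitely_generated H.
Proof.
have img_seq (s : seq G) : theta @` [set` s] = [set` map theta s].
  apply/seteqP; split=> [_ [x xs <-]|y /mapP[x xs ->]] /=; first exact: map_f.
  by exists x.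
split=> [[s' Hs']|[s ->]]; last first.
  by exists (map theta s); rewrite image_generated img_seq.
have [s def_s'] : exists s, s' = map theta s.
  have: [set` s'] `<=` theta @` H by rewrite Hs'; apply: sub_generated.
  elim: s' {Hs'} => [|y s' IH] sub; first by exists [::].
  have [x _ <-] := sub y (mem_head _ _).
  have [|s ->] := IH; last by exists (x :: s).
  by move=> z zs'; apply: sub; rewrite /= inE zs' orbT.
exists s; apply: image_set_inj.
by rewrite /= image_generated img_seq -def_s'.
Qed.

Lemma image_eq1 (H : set G) : theta @` H = [set 1] <-> H = [set 1].
Proof.
have <-: theta @` [set 1] = [set 1] by rewrite image_set1 morph1g.
by split=> [/image_set_inj|->].
Qed.

Lemma image_free_basis (X : eqType) (f : X -> G) (H : set G) :
  free_basis (theta \o f) (theta @` H) <-> free_basis f H.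
Proof.
rewrite /free_basis.
have -> : generated (range (theta \o f)) = theta @` generated (range f).
  by rewrite image_generated image_comp.
have eq1 w : word_value (theta \o f) w = 1 <-> word_value f w = 1.
  rewrite -morph_word_value -morph1g.
  by split=> [/theta_inj|->].
split=> -[genH freef]; split.
- exact: image_set_inj.
- by move=> w rw /eq1; apply: freef.
- by rewrite genH.
- by move=> w rw /eq1; apply: freef.
Qed.

(** A basis of the image lies in the image, so it lifts uniquely: both ranks
    choose from the same set of natural numbers. *)
Lemma rank_image (H : set G) : rank (theta @` H) = rank H.
Proof.
rewrite /rank; congr (xget _ _); apply/seteqP; split=> n /= [f].
  move=> [genf freef].
  have /choice[f' def_f] : forall i, exists x, theta x = f i.
    move=> i; have : (theta @` H) (f i) by rewrite genf; apply: sub_generated.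
    by case=> x _ <-; exists x.
  exists f'; apply/image_free_basis.
  suff -> : theta \o f' = f by [].
  by apply/funext => i /=.
by move=> bf; exists (theta \o f); apply/image_free_basis.
Qed.

Lemma counterexample_image (H K : set G) :
  hanna_neumann_counterexample (theta @` H) (theta @` K) <->
  hanna_neumann_counterexample H K.
Proof.
rewrite /hanna_neumann_counterexample -image_setI_inj !rank_image.
have fgE A := propext (image_fg A); have eq1E A := propext (image_eq1 A).
by rewrite !fgE !eq1E.
Qed.

End Transport.

(** * Reduction to a finitely generated free group *)

Section FiniteAlphabet.
Variables (F : groupType) (X : eqType) (f : X -> F).
Hypothesis f_basis : free_basis f [set: F].

Lemma word_value_surj x : exists w : seq (X * bool), word_value f w = x.
Proof.
have : generated (range f) x by rewrite -f_basis.1.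
apply: (@generated_min _ _ [set x | exists w, word_value f w = x]) => {x};
  last first.
  move=> _ [x _ <-]; exists [:: (x, false)].
  by rewrite word_value_cons /= /word_value big_nil mulg1.
split=> [|_ _ [u <-] [v <-]]; first by exists [::]; rewrite /word_value big_nil.
exists (u ++ rev (map (@inv_letter X) v)).
by rewrite -word_value_inv /word_value big_cat.
Qed.

(** Finitely many elements involve only finitely many letters of the basis;
    the subgroup on these letters is again free on them. *)
Lemma finite_free_factor (t : seq F) :
  exists (n : nat) (psi : free_group 'I_n -> F),
    [/\ {morph psi : x y / x * y}, injective psi & [set` t] `<=` range psi].
Proof.
have [s ts] : exists s : seq X, {in t, forall x, exists2 w,
    word_value f w = x & {in w, forall l, l.1 \in s}}.
  elim: t => [|x t [s IH]]; first by exists [::].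
  have [w wx] := word_value_surj x; exists (map fst w ++ s) => y.
  rewrite inE => /predU1P[-> | /IH[u <- us]].
    by exists w => // l lw; rewrite mem_cat map_f.
  by exists u => // l /us ls; rewrite mem_cat ls orbT.
pose u := undup s; pose f' i := f (tnth (in_tuple u) i).
have tnth_inj : injective (tnth (in_tuple u)).
  by apply/tuple_uniqP; rewrite undup_uniq.
pose psi (g : free_group 'I_(size u)) := word_value f' g.
have psiM : {morph psi : x y / x * y} := word_value_mul f'.
exists (size u), psi; split=> //.
  move=> g h; suff ker1 k : psi k = 1 -> k = 1.
    by move=> gh; apply/divg1_eq/ker1; rewrite psiM morphVg // gh mulgV.
  rewrite /psi -word_value_map => /f_basis.2 w1; apply/val_inj/nilP.
  rewrite /nilp -(size_map (fun l => (tnth (in_tuple u) l.1, l.2))) w1 //.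
  by rewrite reduced_map ?word_reduced.
have sub : is_subgroup (range psi).
  by apply: image_subgroup => //; split.
move=> x /ts[w <- {x} ws].
elim: w ws => [_|[x b] w IH ws].
  by rewrite /word_value big_nil; apply: sub.1.
rewrite word_value_cons; apply: is_subgroupM => //; last first.
  by apply: IH => l lw; apply: ws; rewrite inE lw orbT.
have /tnthP[i xi] : x \in in_tuple u.
  by rewrite mem_undup; apply: (ws (x, b)); apply: mem_head.
have fx : range psi (f x).
  exists (free_gen i) => //.
  by rewrite /psi /= word_value_cons /word_value big_nil mulg1 /= /f' -xi.
by case: b {ws}; [exact: is_subgroupV sub fx | exact: fx].
Qed.


Lemma counterexample_finite_alphabet (H K : set F) :
  hanna_neumann_counterexample H K ->
  exists (n : nat) (H1 K1 : set (free_group 'I_n)),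
    hanna_neumann_counterexample H1 K1.
Proof.
move=> HK; have [[[s1 defH] _] [[s2 defK] _] _] := HK.
have [n [psi [psiM psi_inj sub]]] := finite_free_factor (s1 ++ s2).
have lift (s : seq F) (A : set F) : A = generated [set` s] ->
    {subset s <= s1 ++ s2} -> psi @` (psi @^-1` A) = A.
  move=> -> ss; apply/seteqP; split; first exact: image_preimage_subset.
  have genR : generated [set` s] `<=` range psi.
    apply: generated_min; last by move=> x /ss /sub.
    by apply: image_subgroup => //; split.
  by move=> x xA; have [y _ yx] := genR x xA; exists y; rewrite //= yx.
exists n, (psi @^-1` H), (psi @^-1` K).
apply/(counterexample_image psiM psi_inj).
rewrite (lift s1) ?(lift s2) // => x xs; rewrite mem_cat xs ?orbT //.
Qed.

End FiniteAlphabet.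

(** * Reading words in a deterministic automaton *)

Section Automaton.
Variables (X : choiceType) (S : Type) (step : S -> X * bool -> option S).

(** A partial transition function on letters that is [reversible] is a directed
    graph labelled in [X], possibly infinite, in which no two edges can be
    folded: a letter [(x, true)] follows backwards an edge labelled [x]. *)
Definition reversible :=
  forall s l t, step s l = Some t -> step t (inv_letter l) = Some s.

Fixpoint read (s : S) (w : seq (X * bool)) : option S :=
  if w is l :: w' then obind (read^~ w') (step s l) else Some s.

Lemma read_cat s u v : read s (u ++ v) = obind (read^~ v) (read s u).
Proof. by elim: u s => //= l u IH s; case: (step s l) => /=. Qed.

Hypothesis step_rev : reversible.

(** Cancelling a letter against its inverse removes a backtracking, so a word
    can still be read after reduction; products of group elements are then
    read one after the other. *)
Lemma read_push s l w t :
  read s (l :: w) = Some t -> read s (push l w) = Some t.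
Proof.
case: w => [|m w] //=; case: eqP => [->|//]; case sl: (step s l) => [u|] //=.
by rewrite (step_rev sl).
Qed.

Lemma read_mul s t u (g h : free_group X) :
  read s g = Some t -> read t h = Some u -> read s (g * h) = Some u.
Proof.
rewrite -[word (g * h)]/(mul_word g h) => + th.
elim: (word g) s => [|l w IH] s /=; first by case=> ->.
case sl: (step s l) => [v|] //= /IH vgh.
by apply: read_push; rewrite /= sl.
Qed.

Lemma read_inv s t (g : free_group X) :
  read s g = Some t -> read t g^-1 = Some s.
Proof.
rewrite -[word g^-1]/(inv_word g).
elim: (word g) s => [|l w IH] s /=; first by case=> ->.
case sl: (step s l) => [v|] //= /IH tv.
by rewrite /inv_word /= rev_cons -cats1 read_cat tv /= (step_rev sl).
Qed.

Lemma readX (g : free_group X) (p : nat -> S) n :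
  (forall k, read (p k) g = Some (p k.+1)) -> read (p 0) (g ^+ n) = Some (p n).
Proof.
by move=> pg; elim: n => // n IH; rewrite expgSr; apply: read_mul IH _.
Qed.

End Automaton.

(** * The comb *)

Section Comb.
Variables (G : groupType) (volt : nat -> G).

(** The comb with voltages: a state is a vertex, [(false, k)] on the line or
    [(true, k)] at the tip of a tooth, together with the product of the voltages
    met so far.  Only the bridge from tooth [2i] to tooth [2i+1] carries a
    voltage, [volt i]. *)
Definition comb_state : Type := bool * nat * G.

Definition comb_step (s : comb_state) (l : bool * bool) : option comb_state :=
  let: (tooth, k, g) := s in
  match tooth, l with
  | false, (false, false) => Some (false, k.+1, g)
  | false, (false, true) => if k is k'.+1 then Some (false, k', g) else None
  | false, (true, false) => Some (true, k, g)
  | true, (true, true) => Some (false, k, g)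
  | true, (false, false) =>
      if odd k then None else Some (true, k.+1, g * volt k./2)
  | true, (false, true) =>
      if odd k then Some (true, k.-1, g * (volt k./2)^-1) else None
  | _, _ => None
  end.

Lemma comb_step_rev : reversible comb_step.
Proof.
move=> [[[] k] g] [[] []] [[t k'] g'] //=.
- by case=> <- <- <-.
- case: k => //= k; case: ifP => //= ok [<- <- <-] /=.
  by rewrite (negPf ok) uphalf_half (negPf ok) mulgVK.
- case: ifP => //= ok [<- <- <-] /=.
  by rewrite ok uphalf_half ok mulgK.
- by case=> <- <- <-.
- by case: k => //= k [<- <- <-].
- by case=> <- <- <-.
Qed.

Definition comb_gen (i : nat) : F2 :=
  free_gen false ^+ i.*2 * free_gen true * free_gen false *
  (free_gen true)^-1 * (free_gen false ^+ i.*2.+1)^-1.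

Lemma read_comb_gen i g :
  read comb_step (false, 0, g) (comb_gen i) = Some (false, 0, g * volt i).
Proof.
have line n h :
    read comb_step (false, 0, h) (free_gen false ^+ n) = Some (false, n, h).
  exact: (readX comb_step_rev (p := fun k => (false, k, h))).
have rev := comb_step_rev.
apply: (read_mul rev); last exact: read_inv.
apply: (read_mul rev (t := (true, i.*2.+1, g * volt i))) => //.
apply: (read_mul rev (t := (true, i.*2, g))); last first.
  by rewrite /= odd_double doubleK.
exact: (read_mul rev (t := (false, i.*2, g))).
Qed.

End Comb.

Section CombEmbedding.
Variable X : countType.

Definition comb_embed (w : free_group X) : F2 :=
  word_value (fun x => comb_gen (pickle x)) w.

(** This equation is used twice: with the generators as voltages, where the
    product of the voltages is [w], for injectivity; and with trivial voltages,
    where it says that the image of [w] is a loop of the comb. *)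
Lemma read_comb_embed (G : groupType) (volt : nat -> G) g (w : free_group X) :
  read (comb_step volt) (false, 0, g) (comb_embed w) =
  Some (false, 0, g * word_value (volt \o pickle) w).
Proof.
rewrite /comb_embed; elim: (word w) g => [|[x b] u IH] g.
  by rewrite /word_value !big_nil mulg1.
rewrite !word_value_cons mulgA.
apply: (read_mul (@comb_step_rev _ volt)) (IH _).
case: b; last exact: read_comb_gen.
apply: (read_inv (@comb_step_rev _ volt)).
by rewrite read_comb_gen mulgVK.
Qed.

Lemma comb_embed_inj : injective comb_embed.
Proof.
(* The generator [x] is the voltage of the bridge that its loop crosses. *)
pose volt k : free_group X := oapp (@free_gen X) 1 (unpickle k).
move=> u v uv; have := read_comb_embed volt 1 u.
have eval w : word_value (volt \o pickle) (word w) = w.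
  rewrite -[RHS]word_value_free_gen; congr word_value.
  by apply/funext => x; rewrite /= /volt pickleK.
by rewrite uv read_comb_embed !mul1g !eval => -[].
Qed.

Lemma comb_loop (H : set (free_group X)) (G : groupType) (g : F2) :
  (comb_embed @` H) g ->
  read (comb_step (fun _ => 1 : G)) (false, 0, 1) g = Some (false, 0, 1).
Proof.
case=> w _ <-; rewrite read_comb_embed mul1g /word_value big1 // => -[x b] _.
by rewrite /= invg1 if_same.
Qed.

End CombEmbedding.

(** * Existence of foldings *)

Section Quotient.
Variables (T : finType) (R : T -> T -> Prop).

Let eqv x y := clos_refl_sym_trans _ R x y.

Lemma finite_quotient : exists (Q : finType) (p : T -> Q),
  (forall q, exists x, p x = q) /\ forall x y, p x = p y <-> eqv x y.
Proof.
(* The quotient is made of the equivalence classes, as finite sets. *)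
pose cls x : {set T} := [set y | `[< eqv x y >]]%SET.
pose P := [pred A : {set T} | A \in codom cls].
pose p x : {A | P A} := exist _ (cls x) (codom_f cls x).
exists {A | P A}, p; split.
  by case=> A AP; have /codomP[x Ax] := AP; exists x; apply: val_inj.
move=> x y; split=> [/(congr1 val) /= /setP/(_ y)|xy].
  rewrite !inE => yx; suff : `[< eqv x y >] by move/asboolP.
  by rewrite yx; apply/asboolP; apply: rst_refl.
apply: val_inj; apply/setP => z; rewrite !inE; apply/asboolP/asboolP.
  by apply: rst_trans; apply: rst_sym.
exact: rst_trans.
Qed.

End Quotient.

Section FoldingExistence.
Variable X : finType.
Implicit Types A B : lgraph X.

Lemma identifies_exists A (e1 e2 : edge A) :
  label e1 = label e2 -> exists B, identifies e1 e2 B.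
Proof.
move=> l12.
have [V [p [/choice[sp spK] pE]]] := finite_quotient (fun x y : vertex A =>
  (x = tail e1 /\ y = tail e2) \/ (x = head e1 /\ y = head e2)).
have [E [q [/choice[sq sqK] qE]]] :=
  finite_quotient (fun x y : edge A => x = e1 /\ y = e2).
have q_invariant (I : Type) (h : edge A -> I) : h e1 = h e2 ->
    forall e, h (sq (q e)) = h e.
  move=> h12 e; move: (sq (q e)) (sqK (q e)) => d /qE.
  by elim=> // [_ _ [-> ->] | x y z _ -> _ ->].
exists (LGraph (fun d => p (tail (sq d))) (fun d => p (head (sq d)))
          (fun d => label (sq d)) (p (base A))).
exists p, q; split=> //=; last first.
  by split; [move=> v; exists (sp v) | move=> d; exists (sq d)].
split=> // e.
- by apply: (q_invariant _ (p \o @tail _ A)); apply/pE; apply: rst_step; left.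
- by apply: (q_invariant _ (p \o @head _ A)); apply/pE; apply: rst_step; right.
- exact: (q_invariant _ (@label _ A)).
Qed.

(** The two folded edges cannot both lie in the image of a section of the
    quotient map on edges. *)
Lemma card_edge_fold A B : fold_step A B -> (#|edge B| < #|edge A|)%N.
Proof.
case=> e1 [e2 [[ne12 _ _] [p [q [_ [_ q_surj] _ qE]]]]].
have /choice[sq sqK] := q_surj.
have sq_inj : injective sq := can_inj sqK.
rewrite ltn_neqAle (leq_card sq sq_inj) andbT.
apply: contra_notN ne12 => /eqP eq_card.
have sq_surj := inj_card_onto sq_inj (eq_leq (esym eq_card)).
have /codomP[d1 e1d] := sq_surj e1; have /codomP[d2 e2d] := sq_surj e2.
have : q e1 = q e2 by apply/qE; apply: rst_step.
by rewrite e1d e2d !sqK => ->.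
Qed.

Lemma folding_exists A : exists B,
  clos_refl_trans _ (@fold_step X) A B /\
  forall e1 e2 : edge B, ~ foldable e1 e2.
Proof.
have [n] := ubnP #|edge A|; elim: n A => // n IH A leAn.
have [[e1 [e2 f12]]|noF] := pselect (exists e1 e2 : edge A, foldable e1 e2).
  have [_ l12 _] := f12; have [B AB] := identifies_exists l12.
  have stepAB : fold_step A B by exists e1, e2.
  have [|C [BC foldC]] := IH B.
    exact: leq_trans (card_edge_fold stepAB) _.
  by exists C; split=> //; apply: rt_trans BC; apply: rt_step.
exists A; split=> [|e1 e2 f12]; first exact: rt_refl.
by apply: noF; exists e1, e2.
Qed.

Lemma is_folding_exists (H : set (free_group X)) :
  finitely_generated H -> exists A, is_folding H A.
Proof.
case=> s defH; pose ws := [seq w <- s | w != 1].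
have [A [foldA finA]] := folding_exists (wedge ws).
exists A, ws; split=> //; first by rewrite mem_filter eqxx.
by rewrite defH generated_filter1.
Qed.

End FoldingExistence.

(** * Foldings map to automata *)

Section Tracking.
Variables (X : finType) (S : Type) (step : S -> X * bool -> option S) (s0 : S).
Hypothesis step_rev : reversible step.

(** A map [st] from the vertices of [A] to the states that extends to a
    label-preserving graph morphism; the edges need not be mapped, as a state
    and a letter determine at most one edge of the automaton. *)
Definition tracks (A : lgraph X) (st : vertex A -> S) : Prop :=
  st (base A) = s0 /\
  forall e : edge A, step (st (tail e)) (label e, false) = Some (st (head e)).

(** The vertex reached on a cycle after [j] letters goes to the state reached
    by reading these letters; the cycle closes up because its word is read as
    a loop. *)
Lemma tracks_wedge (ws : seq (free_group X)) :
  {in ws, forall w : free_group X, read step s0 w = Some s0} ->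
  exists st, @tracks (wedge ws) st.
Proof.
move=> loop.
pose prefix (w : seq (X * bool)) j := odflt s0 (read step s0 (take j w)).
pose st (v : wedge_vertex ws) : S :=
  if v is Some ik then prefix (wedge_word (tag ik)) (tagged ik).+1 else s0.
have loop_i i : read step s0 (@wedge_word X ws i) = Some s0.
  by apply: loop; apply: mem_tnth.
have read_take i j : read step s0 (take j (@wedge_word X ws i)) =
    Some (prefix (wedge_word i) j).
  have := loop_i i; rewrite /prefix -{1}(cat_take_drop j (wedge_word i)).
  rewrite read_cat.
  by case: (read step s0 _).
have st_pos i j : (j <= size (@wedge_word X ws i))%N ->
    st (wedge_pos i j) = prefix (wedge_word i) j.
  case: j => [|k] le_k; first by rewrite /prefix take0.
  rewrite /=; case: insubP => [u _ <- //|]; rewrite -leqNgt => ge_k.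
  (* After the last letter, [wedge_pos] is back at the base vertex. *)
  have -> : k.+1 = size (wedge_word i).
    by apply/eqP; rewrite eqn_leq le_k; case: (size _) ge_k {le_k} => //=.
  by rewrite /= /prefix take_size loop_i.
exists st; split=> // -[i j].
have lt_j : (j < size (wedge_word i))%N := ltn_ord j.
pose l : X * bool := tnth (in_tuple (wedge_word i)) j.
have l_nth : nth l (wedge_word i) j = l by rewrite -(tnth_nth l (in_tuple _)).
have adv : step (st (wedge_pos i j)) l = Some (st (wedge_pos i j.+1)).
  rewrite (st_pos _ _ lt_j) (st_pos _ _ (ltnW lt_j)) -read_take.
  rewrite (take_nth l) // -cats1 read_cat read_take /= l_nth.
  by case: (step _ _).
rewrite /= /wedge_letter /= -/l.
case: l {l_nth} adv => x [] /= adv; rewrite ?addn0 ?addn1 //.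
exact: (step_rev adv).
Qed.

(** Two foldable edges have the same image: they leave or enter the same state
    with the same label, and the automaton is deterministic both ways. *)
Lemma tracks_fold (A B : lgraph X) st :
  fold_step A B -> @tracks A st -> exists st', @tracks B st'.
Proof.
case=> e1 [e2 [[_ l12 th12] [p [q [[qt qh ql pb] [p_surj q_surj] pE _]]]]].
case=> st0 stE; have /choice[sp spK] := p_surj.
have [t12 h12] : st (tail e1) = st (tail e2) /\ st (head e1) = st (head e2).
  have [E1 E2] := (stE e1, stE e2).
  case: th12 => [t12|h12]; rewrite ?t12 ?h12; split=> //.
    by move: E1; rewrite t12 l12 E2 => -[].
  move/step_rev: E1; rewrite h12 l12; move/step_rev: E2 => ->.
  by case.
have st_sp u : st (sp (p u)) = st u.
  move: (sp (p u)) (spK (p u)) => u' /pE.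
  by elim=> // [_ _ [] [-> ->] // | x y z _ -> _ ->].
exists (st \o sp); split; first by rewrite /= pb st_sp.
by move=> d; have [e <-] := q_surj d; rewrite qt qh ql /= !st_sp.
Qed.

Lemma tracks_folding (H : set (free_group X)) (A : lgraph X) :
  (forall g, H g -> read step s0 g = Some s0) -> is_folding H A ->
  exists st, @tracks A st.
Proof.
move=> loop [ws [_ defH foldA _]].
have [|st trk] := @tracks_wedge ws.
  by move=> w ww; apply: loop; rewrite defH; apply: sub_generated.
elim: foldA st trk => {A} [A B AB st|A st|A B C _ IHAB _ IHBC st].
- exact: tracks_fold AB.
- by exists st.
- by case/IHAB.
Qed.

Lemma recorded_step (A : lgraph X) st v l :
  @tracks A st -> l \in recorded v -> step (st v) l.
Proof.
move=> [_ stE]; rewrite inE => /existsP[e /andP[/eqP]].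
case: l => x [] /= <- /eqP <-; last by rewrite stE.
by rewrite (step_rev (stE e)).
Qed.

End Tracking.

(** Without foldable edges, the outgoing edges at a vertex have distinct labels,
    and so do the incoming ones, so letters count edge ends one for one; a loop
    has two ends and records two letters. *)
Lemma degree_recorded (X : finType) (A : lgraph X) (v : vertex A) :
  (forall e1 e2 : edge A, ~ foldable e1 e2) -> degree v = #|recorded v|.
Proof.
move=> folded.
pose out := [set (label e, false) | e in [pred e : edge A | tail e == v]]%SET.
pose inn := [set (label e, true) | e in [pred e : edge A | head e == v]]%SET.
have -> : recorded v = out :|: inn.
  apply/setP => -[x b]; rewrite !inE /=; apply/existsP/orP.
    case=> e /andP[/eqP <-]; case: b => ve; [right | left]; exact: imset_f.
  by case=> /imsetP[e ve [-> ->]]; exists e; rewrite eqxx.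
have disj : out :&: inn = finset.set0.
  apply/setP => l; rewrite !inE; apply/negP => /andP[/imsetP[e _ ->]].
  by case/imsetP.
rewrite cardsU disj cards0 subn0 /degree !card_in_imset //.
  move=> e1 e2 /eqP h1 /eqP h2 [l12]; apply: contrapT => ne12.
  by apply: (folded e1 e2); split=> //; right; rewrite h1.
move=> e1 e2 /eqP h1 /eqP h2 [l12]; apply: contrapT => ne12.
by apply: (folded e1 e2); split=> //; left; rewrite h1.
Qed.

(** The type of the branch vertices, with the letters [a], [a^-1], [b]. *)
Definition comb_type : {set bool * bool} := [set~ (true, true)]%SET.

(** A tooth has only two letters, and the line never has [b^-1]. *)
Lemma comb_state_type (G : groupType) (volt : nat -> G) s
    (L : {set bool * bool}) :
  {in L, forall l, comb_step volt s l} -> (3 <= #|L|)%N -> L = comb_type.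
Proof.
move=> Ls L3; case: s Ls => [[[] k] g] Ls.
  suff : (#|L| <= 2)%N by rewrite leqNgt L3.
  have sub : L \subset [set (true, true); (false, odd k)]%SET.
    apply/fintype.subsetP => l /Ls; rewrite !inE.
    by case: l => [[] []] //=; case: (odd k).
  by apply: leq_trans (subset_leq_card sub) _; rewrite cards2; case: eqP.
apply/eqP; rewrite eqEcard; apply/andP; split; last first.
  by rewrite cardsC1 card_prod card_bool.
by apply/fintype.subsetP => l /Ls; rewrite !inE; case: l => [[] []].
Qed.

Lemma comb_folding (X : countType) (H : set (free_group X)) (A : lgraph bool) :
  is_folding (@comb_embed X @` H) A ->
  forall v : vertex A, branch v -> degree v = 3 /\ recorded v = comb_type.
Proof.
move=> foldA v; have [ws [_ _ _ folded]] := foldA.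
have [st trk] := tracks_folding (@comb_step_rev F2 _) (@comb_loop _ H F2) foldA.
rewrite /branch degree_recorded // => v3.
have -> : recorded v = comb_type.
  apply: (comb_state_type (s := st v)) v3 => l.
  exact: (recorded_step (@comb_step_rev F2 _) trk).
by rewrite cardsC1 card_prod card_bool.
Qed.

Theorem corollary1 :
  (exists (F : groupType) (H0 K0 : set F),
     is_free F /\ hanna_neumann_counterexample H0 K0) ->
  exists H K : set F2,
    hanna_neumann_counterexample H K /\
    exists GH GK : lgraph bool,
      [/\ is_folding H GH, is_folding K GK,
          (forall v : vertex GH, branch v -> degree v = 3),
          (forall v : vertex GK, branch v -> degree v = 3) &
          exists T : {set bool * bool},
            (forall v : vertex GH, degree v = 3 -> recorded v = T) /\
            (forall v : vertex GK, degree v = 3 -> recorded v = T)].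
Proof.
move=> [F [H0 [K0 [[X [f f_basis]] ce0]]]].
have [n [H1 [K1 ce1]]] := counterexample_finite_alphabet f_basis ce0.
have ce : hanna_neumann_counterexample
    (@comb_embed 'I_n @` H1) (@comb_embed 'I_n @` K1).
  apply/(counterexample_image (word_value_mul _)) => //.
  exact: comb_embed_inj.
exists (@comb_embed 'I_n @` H1), (@comb_embed 'I_n @` K1); split=> //.
have [[fgH _] [fgK _] _] := ce.
have [GH foldH] := is_folding_exists fgH.
have [GK foldK] := is_folding_exists fgK.
have typH := comb_folding foldH; have typK := comb_folding foldK.
exists GH, GK; split=> //; first by move=> v /typH[].
  by move=> v /typK[].
exists comb_type; split=> v v3.
  by apply: (typH v _).2; rewrite /branch v3.
by apply: (typK v _).2; rewrite /branch v3.
Qed.
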